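(* Let $(\Omega,\mathcal F,\mathbf P)$ be a non-atomic probability space and let $Y$ be a (measurable) random closed convex set in $\mathbb R$ (a random interval). For $t\in\mathbb R$ define $$T_Y((-\infty,t]):=\mathbf P\big(Y\cap(-\infty,t]\neq\emptyset\big),\qquad C_Y((-\infty,t]):=\mathbf P\big(Y\subset(-\infty,t]\big),$$ and for $\alpha\in(0,1)$ let $$T_Y^{-1}(\alpha):=\inf\{t:T_Y((-\infty,t])\ge\alpha\},\qquad C_Y^{-1}(\alpha):=\inf\{t:C_Y((-\infty,t])\ge\alpha\}.$$ Let $\alpha\in(0,1)$. If $m\in[T_Y^{-1}(\alpha),C_Y^{-1}(\alpha)]$, then there exists a measurable selection $y$ of $Y$ such that $F_y^{-1}(\alpha)=m$.
   Context: The probability space is complete. A random interval is $Y(\omega)=[y_L(\omega),y_U(\omega)]$ with $y_L,y_U:\Omega\to\mathbb R$ measurable and $\mathbf P(y_L\le y_U)=1$. A measurable selection of $Y$ is a random variable $y:\Omega\to\mathbb R$ with $y(\omega)\in Y(\omega)$ for $\mathbf P$-a.e. $\omega$. For a real random variable $z$, $F_z(t)=\mathbf P(z\le t)$ and $F_z^{-1}(\alpha)=\inf\{t\in\mathbb R:F_z(t)\ge\alpha\}$ for $\alpha\in(0,1)$ (left-continuous quantile function). *)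

(* Defs.v *)
From HB Require Import structures.
From mathcomp Require Import all_boot all_order all_algebra.
From mathcomp Require Import all_classical all_reals all_analysis.

Set Implicit Arguments.
Unset Strict Implicit.
Unset Printing Implicit Defensive.

Import Order.TTheory GRing.Theory Num.Theory.
Import numFieldNormedType.Exports.

Local Open Scope classical_set_scope.
Local Open Scope ring_scope.
Local Open Scope ereal_scope.

Section random_intervals.
Context {d : measure_display} {T : measurableType d} {R : realType}.
Implicit Types (P : probability T R) (Y : T -> set R).

Definition non_atomic P : Prop :=
  forall A, measurable A -> 0 < P A ->
    exists B, [/\ measurable B, B `<=` A, 0 < P B & P B < P A].

(* The endpoints are real-valued, so Y is a.s. nonempty and compact;
   Y w is empty on the null event where yU w < yL w. *)
Definition random_interval P Y : Prop :=
  exists yL yU : {RV P >-> R},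
    P [set w | (yL w <= yU w)%R] = 1 /\
    (forall w, Y w = `[yL w, yU w]%classic).

Definition measurable_selection P Y (y : {RV P >-> R}) : Prop :=
  {ae P, forall w, Y w (y w)}.

Definition hitting_functional P Y (K : set R) : \bar R :=
  P [set w | Y w `&` K !=set0].

Definition containment_functional P Y (K : set R) : \bar R :=
  P [set w | Y w `<=` K].

End random_intervals.

(* [inf] is a real-valued infimum with a junk value on sets that are empty or
   unbounded below. Neither occurs when 0 < a < 1 and F is the distribution
   function of a real random variable, or the map sending t to the hitting or
   containment functional of a random interval at `]-oo, t]: these F tend to 0
   at -oo and to 1 at +oo. *)
Definition quantile {R : realType} (F : R -> \bar R) (a : R) : R :=
  inf [set t | a%:E <= F t].

(* Main.v *)
Require Import Defs.
From HB Require Import structures.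
From mathcomp Require Import all_boot all_order all_algebra.
From mathcomp Require Import all_classical all_reals all_analysis.
From mathcomp Require Import measurable_realfun.

Import Order.TTheory GRing.Theory Num.Theory.
Import numFieldNormedType.Exports.

Local Open Scope classical_set_scope.
Local Open Scope ring_scope.

(** Almost surely [Y] is the interval with endpoints [yL <= yU], so it hits
    [`]-oo, t]] exactly when [yL <= t] and is contained in it exactly when
    [yU <= t].  The hitting and containment functionals of half-lines are thus
    the distribution functions of [yL] and [yU] ([hitting_functionalE],
    [containment_functionalE]), and the hypothesis on [m] says that it lies
    between the [a]-quantiles of the two endpoints.

    The selection is the point of [Y] closest to [m], namely
    [max(yL, min(m, yU))].  It is at most [m] exactly when [yL] is, and for
    [t < m] it is almost surely at most [t] exactly when [yU] is.  Its distribution function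
    is therefore that of [yL] at [m], where it is at least [a], and that of [yU]
    on the left of [m], where it is less than [a]; its [a]-quantile is [m].
    Both comparisons with [a] come from the Galois connection between a
    distribution function and its quantile function
    ([quantile_cdf_leP]). *)

Section quantile_of_random_variable.
Context (d : measure_display) (T : measurableType d) (R : realType).
Context (P : probability T R) (X : {RV P >-> R}) (a : R).
Hypotheses (a0 : 0 < a) (a1 : a < 1).

(** The distribution function exceeds [a < 1] near [+oo] and is below [a > 0]
    near [-oo], so the infimum defining the quantile is a genuine one. *)
Lemma has_inf_le_cdf : has_inf [set t | (a%:E <= cdf X t)%E].
Proof.
split.
- have /(cvg_cdfy1 X) : nbhs 1%E [set x | (a%:E < x)%E].
    by apply: open_nbhs_nbhs; split; [exact: open_ereal_gt_ereal|].
  case=> M [_ hM]; exists (M + 1) => /=.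
  by apply/ltW/hM; rewrite ltrDl.
- have /(cvg_cdfNy0 X) : nbhs 0%E [set x | (x < a%:E)%E].
    by apply: open_nbhs_nbhs; split; [exact: open_ereal_lt_ereal|].
  case=> M [_ hM]; exists M => t /= at_.
  by rewrite leNgt; apply/negP => /hM /=; rewrite ltNge at_.
Qed.

(** The nontrivial direction is right-continuity of the distribution function,
    by which the infimum defining the quantile is attained. *)
Lemma quantile_cdf_leP t :
  quantile (cdf X) a <= t <-> (a%:E <= cdf X t)%E.
Proof.
have [S0 Slb] := has_inf_le_cdf.
split=> [qt|]; last by move=> at_; apply: ge_inf.
rewrite leNgt; apply/negP => ta.
have /cdf_right_continuous : nbhs (cdf X t) [set x | (x < a%:E)%E].
  by apply: open_nbhs_nbhs; split; [exact: open_ereal_lt_ereal|].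
case=> e /= e0 he.
suff : t + e <= quantile (cdf X) a.
  by move=> /le_trans /(_ qt); rewrite gerDl leNgt e0.
apply: lb_le_inf => // s /= as_; rewrite leNgt; apply/negP => ste.
have [st|ts] := leP s t.
  have := le_trans as_ (cdf_nondecreasing X st).
  by rewrite leNgt ta.
have : (cdf X s < a%:E)%E.
  by apply: he => //=; rewrite ltr0_norm ?subr_lt0// opprB ltrBlDl.
by rewrite ltNge as_.
Qed.

End quantile_of_random_variable.

Section functionals_of_random_interval.
Context (d : measure_display) (T : measurableType d) (R : realType).
Context (P : probability T R).

Lemma eq_probability_on (A B D : set T) :
  measurable A -> measurable B -> measurable D -> P D = 1%E ->
  (forall w, D w -> A w <-> B w) -> P A = P B.
Proof.
move=> mA mB mD PD AB.
have PDC : P (~` D) = 0%E by rewrite probability_setC// PD subee.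
have capD C : measurable C -> P C = P (C `&` D).
  move=> mC; rewrite -(setUIDK C D) measureU0//.
  - by rewrite setUIDK.
  - exact: measurableI.
  - exact: measurableD.
  - apply: (subset_measure0 _ _ _ PDC); [exact: measurableD|exact: measurableC|].
    by move=> w [].
rewrite (capD A)// (capD B)//; congr (P _).
by apply/seteqP; split=> w [? Dw]; split=> //; exact/AB.
Qed.

Context (yL yU : {RV P >-> R}) (Y : T -> set R).
Hypotheses (yLU : P [set w | yL w <= yU w] = 1%E)
  (YE : forall w, Y w = `[yL w, yU w]%classic).

Lemma measurable_le_mfun (X Z : {mfun T >-> R}) :
  measurable [set w | X w <= Z w].
Proof. by rewrite -[X in measurable X]setTI; exact: measurable_fun_le. Qed.

Lemma cdfE (X : {RV P >-> R}) t : cdf X t = P [set w | X w <= t].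
Proof.
by rewrite /cdf /distribution /pushforward; congr (P _).
Qed.

(** On the null event [yU < yL] the set [Y w] is empty: it hits no half-line,
    but it is contained in each of them.  So the events behind the two
    functionals differ from [yL <= t] and [yU <= t] only there: the first is
    an intersection with the event [yL <= yU], the second a union with its
    complement. *)
Lemma hitting_functionalE t : hitting_functional P Y `]-oo, t] = cdf yL t.
Proof.
have mLU := measurable_le_mfun yL yU; have mL := measurable_le_mfun yL (cst t).
have hitE : [set w | Y w `&` `]-oo, t] !=set0] =
    [set w | yL w <= yU w] `&` [set w | yL w <= t].
  apply/seteqP; split=> w /=; rewrite YE.
    move=> [x []] /=; rewrite !in_itv/= => /andP[Lx xU] xt.
    by split; [exact: le_trans xU|exact: le_trans xt].
  by case=> LU Lt; exists (yL w); split; rewrite /= in_itv/= ?lexx.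
rewrite cdfE /hitting_functional hitE.
apply: eq_probability_on yLU _ => //; first exact: measurableI.
by move=> w LU; split=> [[]|].
Qed.

Lemma containment_functionalE t :
  containment_functional P Y `]-oo, t] = cdf yU t.
Proof.
have mLU := measurable_le_mfun yL yU; have mU := measurable_le_mfun yU (cst t).
have subE : [set w | Y w `<=` `]-oo, t]] =
    ~` [set w | yL w <= yU w] `|` [set w | yU w <= t].
  apply/seteqP; split=> w /=; rewrite YE.
    have [LU Yt|LU _] := leP (yL w) (yU w); last by left.
    by right; have := Yt (yU w); rewrite /= !in_itv/= lexx LU; exact.
  move=> h x /=; rewrite !in_itv/= => /andP[Lx xU].
  by case: h => [[]|]; exact: le_trans xU.
rewrite cdfE /containment_functional subE.
apply: eq_probability_on yLU _ => //.
  by apply: measurableU => //; exact: measurableC.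
by move=> w LU; split=> [[|]|] //; right.
Qed.

End functionals_of_random_interval.

Theorem proposition2p4 (d : measure_display) (T : measurableType d)
    (R : realType) (P : probability T R)
    (Pcomplete : measure_is_complete P) (Pnonatomic : non_atomic P)
    (Y : T -> set R) (Yint : random_interval P Y)
    (a : R) (a0 : 0 < a) (a1 : a < 1) (m : R)
    (mlo : quantile (fun t => hitting_functional P Y `]-oo, t]) a <= m)
    (mhi : m <= quantile (fun t => containment_functional P Y `]-oo, t]) a) :
  exists y : {RV P >-> R},
    measurable_selection Y y /\ quantile (cdf y) a = m.
Proof.
have [yL [yU [yLU YE]]] := Yint.
have mLU := measurable_le_mfun _ _ _ yL yU.
rewrite (_ : (fun t => _) = cdf yL) in mlo; last first.
  by apply/funext => t; exact: hitting_functionalE yLU YE t.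
rewrite (_ : (fun t => _) = cdf yU) in mhi; last first.
  by apply/funext => t; exact: containment_functionalE yLU YE t.
pose y : {RV P >-> R} := yL \max (cst m \min yU).
exists y; split.
  have : P (~` [set w | yL w <= yU w]) = 0%E.
    by rewrite probability_setC// yLU subee.
  move/(negligibleP _ (measurableC mLU)); apply: negligibleS => w /=.
  apply: contra_not => LU.
  by rewrite YE /= in_itv/= /y /= le_max lexx/= ge_max LU ge_min lexx orbT.
have ym : cdf y m = cdf yL m.
  rewrite !cdfE; congr (P _); apply/seteqP; split=> w /=;
  by rewrite /y /= ge_max ge_min lexx andbT.
have y_lt t : t < m -> cdf y t = cdf yU t.
  move=> tm; rewrite !cdfE.
  apply: eq_probability_on yLU _ => //;
    [exact: (measurable_le_mfun _ _ _ _ (cst t))..|].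
  move=> w /= LU; rewrite /y /= ge_max ge_min (leNgt m t) tm/=.
  by split=> [/andP[]//|Ut]; rewrite Ut (le_trans LU Ut).
apply/eqP; rewrite eq_le; apply/andP; split.
  by apply/quantile_cdf_leP => //; rewrite ym; exact/quantile_cdf_leP.
(* At a quantile of [y] below [m] the distribution functions of [y] and [yU]
   agree and are at least [a], which would put the quantile of [yU] below [m]. *)
rewrite leNgt; apply/negP => qm.
have : (a%:E <= cdf y (quantile (cdf y) a))%E by exact/quantile_cdf_leP.
rewrite y_lt// => /quantile_cdf_leP -/(_ a0 a1) /(le_trans mhi).
by rewrite leNgt qm.
Qed.
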